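(* Let $Q$ be a polynomial ring over a field, and let $I=(m_1,\dots,m_q)$ be a monomial ideal of $Q$ with minimal monomial generators $m_1,\dots,m_q$. Let $l=\operatorname{Scarf-number}(I)$; assume $l<\infty$, that $l+1$ is a gap of $[l]$, and that $\mathcal{T}_{1,\dots,l}$ is a pivot resolution of $Q/I$. Let $a_1,\dots,a_r$ be a regular sequence in $Q$ with $(a_1,\dots,a_r)\subseteq I$, and write $a_s=a_{s1}m_1+\cdots+a_{sq}m_q$ with $a_{sj}\in Q$ for $s\in[r]$, $j\in[q]$. Let $\delta$ denote the differential of $\mathcal{T}_{1,\dots,l}$. For $s\in[r]$ and each $A\subseteq[q]$ with $A\nsupseteq[l]$, define $\sigma_{\mathbf{e}_s}(\epsilon_A)$ as follows. (i) If $|A\cap[l]|\ne l-1$: $$\sigma_{\mathbf{e}_s}(\epsilon_A)=\sum_{j\notin A}\operatorname{sgn}(j,A)\,a_{sj}\frac{m_jm_A}{m_{A\cup j}}\,\epsilon_{A\cup j}.$$ (ii) If $[l]\setminus A=\{t\}$ and $l+1\in A$: $$\sigma_{\mathbf{e}_s}(\epsilon_A)=\sum_{j\notin A\cup t}\operatorname{sgn}(j,A)\,a_{sj}\frac{m_jm_A}{m_{A\cup j}}\,\epsilon_{A\cup j}.$$ (iii) If $[l]\setminus A=\{t\}$ and $l+1\notin A$: $$\sigma_{\mathbf{e}_s}(\epsilon_A)=\sum_{j\notin A\cup t}\operatorname{sgn}(j,A)\,a_{sj}\frac{m_jm_A}{m_{A\cup j}}\,\epsilon_{A\cup j}+(-1)^{l+1}\operatorname{sgn}(t,A)\,a_{st}\sum_{i\in[l]}\operatorname{sgn}(i,A\cup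 t\setminus i)\frac{m_tm_A}{m_{A\cup t\cup(l+1)\setminus i}}\,\epsilon_{A\cup t\cup(l+1)\setminus i}.$$ Set also $\sigma_{\mathbf{0}}=\delta$ and $\sigma_{\mathbf{u}}=0$ for $\mathbf{u}\in\mathbb{N}^r$ with $|\mathbf{u}|\ge2$. Then $(\sigma_{\mathbf{u}})_{\mathbf{u}\in\mathbb{N}^r}$ is a system of higher homotopies for $a_1,\dots,a_r$ on the pivot resolution $\mathcal{T}_{1,\dots,l}$.
   Context: Notation. $[q]=\{1,\dots,q\}$; $\mathcal{P}([q])$ is its power set. Single integers are identified with singletons in set operations, e.g. $A\cup t\cup(l+1)\setminus i=(A\cup\{t\}\cup\{l+1\})\setminus\{i\}$; in sums, $j\notin A$ means $j\in[q]\setminus A$. For $A\subseteq[q]$, $m_A=\operatorname{lcm}(m_i : i\in A)$, $m_\emptyset=1$. For $A,B\subseteq[q]$ (elements listed increasingly), $\operatorname{sgn}(A,B)=0$ if $A\cap B\neq\emptyset$, and otherwise $\operatorname{sgn}(A,B)=(-1)^{p}$ where $p$ is the number of transpositions needed to sort the concatenated sequence $A,B$ into increasing order; thus for $i\notin A$, $\operatorname{sgn}(i,A)=(-1)^{|\{j\in A : j<i\}|}$. Scarf number. $\operatorname{Scarf-number}(I)=\inf\{t\in\mathbb{N} : \exists\,\tau,\tau'\in\mathcal{P}([q])\text{ with }\tau\ne\tau',\ |\tau|=t,\ m_\tau=m_{\tau'}\}$. Gap. For $\tau\subseteq[q]$ and $h\in[q]\setminus\tau$, $h$ is a gap of $\tau$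 if $m_h\mid m_\tau$. Taylor and pivot complexes. The Taylor resolution $\mathcal{T}$ of $Q/I$ has degree-$i$ component free over $Q$ with basis $\{\epsilon_\tau : \tau\subseteq[q],\ |\tau|=i\}$ and differential $\partial(\epsilon_\tau)=\sum_{j\in\tau}\operatorname{sgn}(j,\tau\setminus j)\frac{m_\tau}{m_{\tau\setminus j}}\epsilon_{\tau\setminus j}$. For $l\ge2$, the pivot complex $\mathcal{T}_{1,\dots,l}$ is the subcomplex spanned over $Q$ by the $\epsilon_A$ with $A\nsupseteq[l]$; it is called a pivot resolution if it is a free resolution of $Q/I$. System of higher homotopies. $\mathbb{N}$ includes $0$; $\mathbf{e}_i$ is the $i$-th standard basis vector of $\mathbb{N}^r$, and $|\mathbf{u}|=\sum_i u_i$. For a complex $\mathcal{F}$ of free $Q$-modules with differential $\partial$, a system of higher homotopies for $a_1,\dots,a_r$ on $\mathcal{F}$ is a collection of $Q$-linear maps $\sigma_{\mathbf{u}}$ ($\mathbf{u}\in\mathbb{N}^r$), where $\sigma_{\mathbf{u}}$ maps $\mathcal{F}_i$ to $\mathcal{F}_{i+2|\mathbf{u}|-1}$ for all $i$, such that: (1) $\sigma_{\mathbf{0}}=\partial$; (2) for each $i\in[r]$, $\sigma_{\mathbf{0}}\sigma_{\mathbf{e}_i}+\sigma_{\mathbf{e}_i}\sigma_{\mathbf{0}}$ is multiplication by $a_i$ on $\mathcal{F}$; (3) if $|\mathbf{u}|\ge2$, then $\sum_{\mathbf{b}+\mathbf{b}'=\mathbf{u}}\sigma_{\mathbf{b}}\sigma_{\mathbf{b}'}=0$.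 *)

(* Defs.v *)
From HB Require Import structures.
From mathcomp Require Import all_boot all_order all_algebra.
From mathcomp Require Import mpoly.

Set Implicit Arguments.
Unset Strict Implicit.
Unset Printing Implicit Defensive.

Import GRing.Theory.
Local Open Scope ring_scope.

Section Ideals.
Variable Q : comNzRingType.

(* The ideal generated by the g j such that P j. *)
Definition in_ideal (q : nat) (P : pred 'I_q) (g : 'I_q -> Q) (x : Q) : Prop :=
  exists c : 'I_q -> Q, x = \sum_(j | P j) c j * g j.

Definition minimal_generators (q : nat) (g : 'I_q -> Q) : Prop :=
  forall j, ~ in_ideal (fun i => i != j) g (g j).

Definition regular_sequence (r : nat) (a : 'I_r -> Q) : Prop :=
  ~ in_ideal predT a 1 /\
  forall (s : 'I_r) (x : Q),
    in_ideal (fun i => i < s)%N a (a s * x) -> in_ideal (fun i => i < s)%N a x.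

End Ideals.

(* A graded free module is given by a finite basis [B] and the homological
   degrees [deg] of the basis elements; its underlying module is
   {ffun B -> Q^o}.  The regular module Q^o matters: when Q is itself an algebra
   over a field k, {ffun B -> Q} would be read as a k-module. *)

Section LinearExtension.
Variables (Q : comNzRingType) (B C : finType).

Definition lin_ext (f : B -> {ffun C -> Q^o}) (x : {ffun B -> Q^o}) :
  {ffun C -> Q^o} := \sum_(b : B) (x b : Q) *: f b.

Fact lin_ext_is_linear (f : B -> {ffun C -> Q^o}) : linear (lin_ext f).
Proof.
move=> c x y; rewrite /lin_ext scaler_sumr -big_split; apply: eq_bigr => b _ /=.
by rewrite !ffunE scalerDl scalerA.
Qed.

HB.instance Definition _ (f : B -> {ffun C -> Q^o}) :=
  GRing.isLinear.Build Q {ffun B -> Q^o} {ffun C -> Q^o} *:%R (lin_ext f)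
    (lin_ext_is_linear f).

End LinearExtension.

Section FreeComplexes.
Variables (Q : comNzRingType) (B : finType) (deg : B -> nat).
Local Notation F := {ffun B -> Q^o}.

(* The component in degree i, which is zero for i < 0. *)
Definition in_degree (i : int) (x : F) : Prop :=
  forall b, x b != 0 -> (deg b)%:Z = i.

Definition is_free_complex (d : {linear F -> F}) : Prop :=
  (forall (i : int) (x : F), in_degree i x -> in_degree (i - 1) (d x)) /\
  (forall x : F, d (d x) = 0).

(* Free resolution of Q/I.  As the component of degree 0 is free, its
   augmentation to Q/I is represented by a lift [aug] with values in Q; the
   conditions on [aug] say that the induced map to Q/I is surjective with kernel
   the image of the component of degree 1. *)
Definition is_free_resolution (d : {linear F -> F}) (I : Q -> Prop) : Prop :=
  [/\ is_free_complex d,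
      exists aug : {linear F -> Q^o},
        (forall c : Q, exists2 x : F, in_degree 0 x & I (aug x - c)) /\
        (forall x : F, in_degree 0 x ->
           (I (aug x) <-> exists2 y : F, in_degree 1 y & d y = x)) &
      forall (i : int) (x : F), 0 < i -> in_degree i x -> d x = 0 ->
        exists2 y : F, in_degree (i + 1) y & d y = x].

(* The multi-indices u in N^r are the multinomials 'X_{1..r}; mdeg u is |u|. *)
Definition higher_homotopies (d : {linear F -> F}) (r : nat) (a : 'I_r -> Q)
    (sigma : 'X_{1..r} -> {linear F -> F}) : Prop :=
  [/\ forall (u : 'X_{1..r}) (i : int) (x : F),
        in_degree i x -> in_degree (i + (2 * mdeg u)%N%:Z - 1) (sigma u x),
      forall x : F, sigma 0%MM x = d x,
      forall (i : 'I_r) (x : F),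
        sigma 0%MM (sigma U_(i)%MM x) + sigma U_(i)%MM (sigma 0%MM x)
        = a i *: x &
      forall (u : 'X_{1..r}), (2 <= mdeg u)%N -> forall x : F,
        \sum_(b : 'X_{1..r < (mdeg u).+1, (mdeg u).+1} | (b.1 + b.2)%MM == u)
          sigma b.1 (sigma b.2 x) = 0].

End FreeComplexes.

(* Indices are 0-based: the element i of [q] = {1, ..., q} is the ordinal of
   value i - 1 in 'I_q. *)

(* [set i | i < l] is the subset [l] = {1, ..., l} of [q]. *)
Definition initial (q l : nat) : {set 'I_q} := [set i : 'I_q | (i < l)%N].

(* The number of transpositions that sort A, B has the parity of the number of
   inversions of the sequence. *)
Definition sgn (R : nzRingType) (q : nat) (A B : {set 'I_q}) : R :=
  if [disjoint A & B]
  then (-1) ^+ #|[set p in setX A B | (p.2 < p.1)%N]| else 0.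

Section Monomials.
Variables (n q : nat) (m : 'I_q -> 'X_{1..n}).

Definition lcm_set (A : {set 'I_q}) : 'X_{1..n} :=
  \big[@mlcm n/0%MM]_(i in A) m i.

(* t = |tau| for some tau in the set defining the Scarf number. *)
Definition scarf_witness (t : nat) : bool :=
  [exists tau : {set 'I_q}, exists tau' : {set 'I_q},
    [&& tau != tau', #|tau| == t & lcm_set tau == lcm_set tau']].

(* [None] stands for infinity; no subset of [q] has more than q elements. *)
Definition scarf_number : option nat :=
  ohead [seq t <- iota 0 q.+1 | scarf_witness t].

Lemma scarf_numberP (l : nat) :
  scarf_number = Some l <->
  scarf_witness l /\ (forall t, scarf_witness t -> (l <= t)%N).
Proof.
have wq t : scarf_witness t -> (t < q.+1)%N.
  case/existsP=> tau /existsP [tau' /and3P [_ /eqP <- _]].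
  by have := max_card tau; rewrite card_ord.
rewrite /scarf_number; split=> [|[wl lmin]].
  case Es : [seq _ <- _ | _] => [//|t s] /= [<-].
  have : t \in t :: s by rewrite mem_head.
  rewrite -Es mem_filter => /andP [wt _]; split=> // t' wt'.
  have : sorted leq (t :: s).
    by rewrite -Es sorted_filter ?iota_sorted //; apply: leq_trans.
  move=> /(order_path_min leq_trans) /allP mins.
  have : t' \in t :: s by rewrite -Es mem_filter wt' mem_iota /= wq.
  by rewrite inE => /predU1P [->|/mins].
case Es : [seq _ <- _ | _] => [|t s] /=.
  have : l \in [seq t <- iota 0 q.+1 | scarf_witness t].
    by rewrite mem_filter wl mem_iota /= wq.
  by rewrite Es.
have : t \in t :: s by rewrite mem_head.
rewrite -Es mem_filter => /andP [wt _].
have : l \in t :: s by rewrite -Es mem_filter wl mem_iota /= wq.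
rewrite inE => /predU1P [->//|ls].
have : sorted leq (t :: s).
  by rewrite -Es sorted_filter ?iota_sorted //; apply: leq_trans.
move=> /(order_path_min leq_trans) /allP /(_ _ ls) tl.
by congr Some; apply/eqP; rewrite eqn_leq tl lmin.
Qed.

Definition is_gap (h : 'I_q) (tau : {set 'I_q}) : bool :=
  (h \notin tau) && (m h <= lcm_set tau)%MM.

End Monomials.

Section PivotComplex.
Variables (k : fieldType) (n q : nat) (m : 'I_q -> 'X_{1..n}) (l : nat).
Local Notation Q := {mpoly k[n]}.
Local Notation mA := (lcm_set m).

Definition monomial_ideal : Q -> Prop :=
  in_ideal predT (fun j => 'X_[m j] : Q).

Definition face : finType := {A : {set 'I_q} | ~~ (initial q l \subset A)}.

Definition face_deg (A : face) : nat := #|val A|.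

Definition pivot_module : lmodType Q := {ffun face -> Q^o}.

(* The basis element of the face A, and 0 when A is not a face. *)
Definition eps (A : {set 'I_q}) : pivot_module :=
  [ffun A' : face => (val A' == A)%:R].

(* The restriction of the Taylor differential; faces are closed under taking
   subsets.  Here and below, monomials are divided by the truncated subtraction
   of their exponents, which is exact as the divisions are. *)
Definition pivot_diff : {linear pivot_module -> pivot_module} :=
  lin_ext (fun A : face =>
    \sum_(j in val A)
      (sgn Q [set j] (val A :\ j) * 'X_[mA (val A) - mA (val A :\ j)])
        *: eps (val A :\ j)).

Definition is_pivot_resolution : Prop :=
  (2 <= l)%N /\ is_free_resolution face_deg pivot_diff monomial_ideal.

(* The homotopy of a_s, where a_s is the sum of the c j * m_j and l1 is the index
   l + 1. *)
Section Homotopy.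
Variables (l1 : 'I_q) (c : 'I_q -> Q).

(* The sum over j not in D of the terms of the Taylor homotopy. *)
Definition taylor_sum (A D : {set 'I_q}) : pivot_module :=
  \sum_(j | j \notin D)
    (sgn Q [set j] A * c j * 'X_[m j + mA A - mA (j |: A)]) *: eps (j |: A).

Definition pivot_sum (t : 'I_q) (A : {set 'I_q}) : pivot_module :=
  \sum_(i in initial q l)
    (sgn Q [set i] ((t |: A) :\ i)
       * 'X_[m t + mA A - mA ((t |: (l1 |: A)) :\ i)])
      *: eps ((t |: (l1 |: A)) :\ i).

Definition homotopy_basis (A : {set 'I_q}) : pivot_module :=
  if #|A :&: initial q l| != l.-1 then taylor_sum A A
  else if [pick t in initial q l :\: A] is Some t then
    if l1 \in A then taylor_sum A (t |: A)
    else taylor_sum A (t |: A)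
         + ((-1) ^+ l.+1 * sgn Q [set t] A * c t) *: pivot_sum t A
  else 0.

Definition homotopy : {linear pivot_module -> pivot_module} :=
  lin_ext (fun A : face => homotopy_basis (val A)).

Lemma lin_ext_eps (f : face -> pivot_module) (A : face) :
  lin_ext f (eps (val A)) = f A.
Proof.
rewrite /lin_ext (bigD1 A) //= big1 ?addr0 => [|B neBA].
  by rewrite ffunE eqxx scale1r.
by rewrite ffunE val_eqE (negbTE neBA) scale0r.
Qed.

Lemma homotopyE (A : face) : homotopy (eps (val A)) = homotopy_basis (val A).
Proof. exact: lin_ext_eps. Qed.

Lemma homotopy_basis_i (A : {set 'I_q}) :
  #|A :&: initial q l| != l.-1 -> homotopy_basis A = taylor_sum A A.
Proof. by rewrite /homotopy_basis => ->. Qed.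

Lemma card_initial : l1 = l :> nat -> #|initial q l| = l.
Proof.
move=> l1E; have lq : (l <= q)%N by rewrite -l1E ltnW.
have -> : initial q l = [set widen_ord lq i | i : 'I_l].
  apply/setP=> i; rewrite inE; apply/idP/imsetP=> [il|[j _ ->] /=].
    by exists (Ordinal il); rewrite ?inE //; apply: val_inj.
  exact: ltn_ord.
by rewrite card_imset ?card_ord // => i j /(congr1 val) ij; apply: val_inj.
Qed.

Lemma homotopy_basis_missing (A : {set 'I_q}) (t : 'I_q) :
  l1 = l :> nat -> initial q l :\: A = [set t] ->
  homotopy_basis A =
    if l1 \in A then taylor_sum A (t |: A)
    else taylor_sum A (t |: A)
         + ((-1) ^+ l.+1 * sgn Q [set t] A * c t) *: pivot_sum t A.
Proof.
move=> l1E At; rewrite /homotopy_basis.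
have -> : #|A :&: initial q l| = l.-1.
  have := cardsID A (initial q l).
  rewrite At cards1 card_initial // addn1 [_ :&: A]setIC.
  by move/(congr1 predn).
rewrite eqxx /=; case: pickP => [t'|/(_ t)]; last by rewrite At set11.
by rewrite /= At inE => /eqP ->.
Qed.

End Homotopy.

(* c s j is the coefficient a_{sj} in a_s = a_{s1} m_1 + ... + a_{sq} m_q. *)
Definition pivot_homotopies (l1 : 'I_q) (r : nat) (c : 'I_r -> 'I_q -> Q)
    (u : 'X_{1..r}) : {linear pivot_module -> pivot_module} :=
  if u == 0%MM then pivot_diff
  else if [pick s | u == U_(s)%MM] is Some s then homotopy l1 (c s)
  else lin_ext (fun _ => 0).

End PivotComplex.

(* Main.v *)
Require Import Defs.
From mathcomp Require Import all_boot all_order all_algebra.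
From mathcomp Require Import mpoly ring.
From HB Require Import structures.

(* Rescaling the basis element of A by m_A embeds the pivot complex in the
   exterior algebra of Q^q, where the differential becomes the contraction d by
   (1, ..., 1) and the Taylor homotopy becomes the left multiplication W by the
   vector of the a_sj m_j; hence d W + W d = a_s, and the W anticommute.  Write
   e_C for the monomial of C, e for e_{l+1} and d' for the contraction by the
   indicator vector of [l].  The map pi that fixes e_C if C does not contain
   [l], and sends e_C to e d'(e_C) otherwise, is a projection onto the span of
   the pivot faces; it commutes with d, and its kernel is a left ideal.  The
   formulas (i)-(iii) say that the homotopy is pi W, so the relations for W
   descend. *)

Set Implicit Arguments.
Unset Strict Implicit.
Unset Printing Implicit Defensive.

Import GRing.Theory.
Local Open Scope ring_scope.

(* In characteristic 2 the vanishing of the diagonal does not follow from the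
   antisymmetry. *)
Lemma sum_antisym (V : zmodType) (I : finType) (f : I -> I -> V) :
  (forall i, f i i = 0) -> (forall i j, f i j = - f j i) ->
  \sum_i \sum_j f i j = 0.
Proof.
move=> f0 fN; pose lt (i j : I) := (enum_rank i < enum_rank j)%N.
have split_lt i : \sum_j f i j =
    \sum_j (if lt i j then f i j else 0) + \sum_j (if lt j i then f i j else 0).
  rewrite -big_split; apply: eq_bigr => j _ /=; rewrite /lt.
  by case: ltngtP => [||/val_inj/enum_rank_inj ->]; rewrite ?addr0 ?add0r.
rewrite (eq_bigr _ (fun i _ => split_lt i)) big_split /=.
rewrite [X in _ + X]exchange_big.
rewrite -big_split big1 //= => i _; rewrite -big_split big1 //= => j _.
by case: ifP => _; rewrite ?addr0 // fN addNr.
Qed.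

(** * Signs, multiplication and contraction in the exterior algebra *)

Section ExteriorAlgebra.
Variables (Q : comNzRingType) (q : nat).
Implicit Types (i j : 'I_q) (A B L : {set 'I_q}) (v w : 'I_q -> Q).
Local Notation E := {ffun {set 'I_q} -> Q^o}.
Implicit Types x y : E.

(** The sign of moving [j] past the smaller elements of [B]. Unlike [sgn], it stays nonzero when [j]
    lies in [B], so that [B] and [B :\ j] carry the same sign. *)
Definition ext_sign j B : Q := (-1) ^+ #|[set i in B | (i < j)%N]|.

Definition ext_basis A : E := [ffun B : {set 'I_q} => (B == A)%:R].

(** Left multiplication by the generator e_j, given by coefficients: e_B can only arise from e_{B \
    j}. *)
Definition wedge j x : E :=
  [ffun B : {set 'I_q} => if j \in B then ext_sign j B * x (B :\ j) else 0].

(** The interior product with the dual of e_j: the antiderivation sending e_j to 1 and the other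
    generators to 0. *)
Definition contract j x : E :=
  [ffun B : {set 'I_q} => if j \in B then 0 else ext_sign j B * x (j |: B)].

Fact wedge_is_linear j : linear (wedge j).
Proof.
move=> a x y; apply/ffunP=> B; rewrite !ffunE; case: ifP => _.
  by rewrite mulrDr /GRing.scale /= mulrCA.
by rewrite scaler0 addr0.
Qed.

HB.instance Definition _ j :=
  GRing.isLinear.Build Q E E *:%R (wedge j) (wedge_is_linear j).

Fact contract_is_linear j : linear (contract j).
Proof.
move=> a x y; apply/ffunP=> B; rewrite !ffunE; case: ifP => _.
  by rewrite scaler0 addr0.
by rewrite mulrDr /GRing.scale /= mulrCA.
Qed.

HB.instance Definition _ j :=
  GRing.isLinear.Build Q E E *:%R (contract j) (contract_is_linear j).

Lemma ext_sign_setU1 i j B :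
  i \notin B -> ext_sign j (i |: B) = (-1) ^+ (i < j)%N * ext_sign j B.
Proof.
move=> iB; rewrite /ext_sign -exprD; congr (_ ^+ _); case: ltnP => ij.
  have -> : [set a in i |: B | (a < j)%N] = i |: [set a in B | (a < j)%N].
    by apply/setP=> a; rewrite !inE andb_orl; case: eqP => // ->; rewrite ij.
  by rewrite cardsU1 inE (negbTE iB).
apply: eq_card => a; rewrite !inE andb_orl.
by case: eqP => // ->; rewrite ltnNge ij.
Qed.

Lemma ext_sign_setD1 i j B :
  i \in B -> ext_sign j (B :\ i) = (-1) ^+ (i < j)%N * ext_sign j B.
Proof.
move=> iB; rewrite -{2}(setD1K iB) ext_sign_setU1 ?setD11 //.
by rewrite mulrA -signr_addb addbb mul1r.
Qed.

Lemma ext_sign_setD1id j B : j \in B -> ext_sign j (B :\ j) = ext_sign j B.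
Proof. by move=> jB; rewrite ext_sign_setD1 // ltnn mul1r. Qed.

Lemma ext_sign_sqr j B : ext_sign j B * ext_sign j B = 1.
Proof. by rewrite /ext_sign -exprD addnn -mul2n exprM sqrrN !expr1n. Qed.

Lemma sgn_ext_sign j B : j \notin B -> sgn Q [set j] B = ext_sign j B.
Proof.
move=> jB; rewrite /sgn disjoints1 jB /ext_sign; congr (_ ^+ _).
have pair_inj : injective (pair j : 'I_q -> 'I_q * 'I_q) by move=> a b [].
rewrite -(card_imset _ pair_inj).
apply: eq_card => -[a b]; rewrite !inE /=.
apply/idP/imsetP => [/andP[/andP[/eqP-> bB] bj]|[b']].
  by exists b; rewrite // inE bB.
by rewrite inE => /andP[b'B b'j] [-> ->]; rewrite eqxx b'B.
Qed.

Lemma wedge_basis j A :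
  wedge j (ext_basis A) =
  if j \in A then 0 else ext_sign j A *: ext_basis (j |: A).
Proof.
apply/ffunP=> B; case jA: (j \in A); rewrite !ffunE.
  case: ifP => // jB; case: eqP => [BA|]; last by rewrite mulr0.
  by move: jA; rewrite -BA setD11.
case: (B =P j |: A) => [->|BA].
  rewrite setU11 setU1K ?jA // eqxx ext_sign_setU1 ?jA // ltnn mul1r.
  by [].
case: ifP => [jB|_]; last by rewrite /GRing.scale /= mulr0.
case: eqP => [BA'|_]; last by rewrite /GRing.scale /= !mulr0.
by case: BA; rewrite -BA' setD1K.
Qed.

Lemma contract_basis j A :
  contract j (ext_basis A) =
  if j \in A then ext_sign j A *: ext_basis (A :\ j) else 0.
Proof.
apply/ffunP=> B; case jA: (j \in A); rewrite !ffunE.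
  case: (B =P A :\ j) => [->|BA].
    by rewrite setD11 setD1K // eqxx ext_sign_setD1id.
  case: ifP => [jB|jB]; first by rewrite /GRing.scale /= mulr0.
  case: eqP => [BA'|_]; last by rewrite /GRing.scale /= !mulr0.
  by case: BA; rewrite -BA' setU1K ?jB.
case: ifP => // jB; case: eqP => [BA|_]; last by rewrite mulr0.
by move: jA; rewrite -BA setU11.
Qed.

(** Exactly one of the two comparisons holds; the anticommutation of distinct generators takes its
    sign from this. *)
Lemma ext_sign_swap i j : i != j ->
  (-1) ^+ (i < j)%N = - (-1) ^+ (j < i)%N :> Q.
Proof.
by rewrite neq_ltn => /orP[]ij; rewrite ij ltnNge (ltnW ij) /= ?opprK.
Qed.

Lemma wedge_wedge i x : wedge i (wedge i x) = 0.
Proof.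
by apply/ffunP=> B; rewrite !ffunE setD11 mulr0; case: ifP.
Qed.

Lemma wedgeC i j x : wedge i (wedge j x) = - wedge j (wedge i x).
Proof.
have [->|ij] := eqVneq i j; first by rewrite wedge_wedge oppr0.
apply/ffunP=> B; rewrite !ffunE !in_setD1 ij eq_sym ij /=.
case iB: (i \in B); case jB: (j \in B); rewrite ?mulr0 ?oppr0 //.
rewrite !ext_sign_setD1 // !setDDl [[set j] :|: _]setUC.
rewrite (ext_sign_swap ij); ring.
Qed.

Lemma contract_contract i x : contract i (contract i x) = 0.
Proof.
by apply/ffunP=> B; rewrite !ffunE setU11 mulr0; case: ifP.
Qed.

Lemma contractC i j x : contract i (contract j x) = - contract j (contract i x).
Proof.
have [->|ij] := eqVneq i j; first by rewrite contract_contract oppr0.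
apply/ffunP=> B; rewrite !ffunE !in_setU1 (negbTE ij) eq_sym (negbTE ij) /=.
case iB: (i \in B); case jB: (j \in B); rewrite ?mulr0 ?oppr0 //.
rewrite !ext_sign_setU1 ?iB ?jB // [j |: (i |: B)]setUCA.
by rewrite (ext_sign_swap ij); ring.
Qed.

(** The Clifford relation. For [i = j], exactly one of the two composites is nonzero on a given
    monomial, and it restores the monomial because the sign occurs squared. *)
Lemma wedge_contract i j x :
  wedge i (contract j x) = (i == j)%:R *: x - contract j (wedge i x).
Proof.
apply/ffunP=> B; rewrite !ffunE !(in_setU1, in_setD1).
have [<-|ij] := eqVneq i j.
  rewrite scale1r /=; case: ifP => iB.
    by rewrite setD1K // ext_sign_setD1id // mulrA ext_sign_sqr mul1r subr0.
  rewrite setU1K ?iB // ext_sign_setU1 ?iB // ltnn mul1r.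
  by rewrite mulrA ext_sign_sqr mul1r subrr.
rewrite scale0r add0r /=.
case iB: (i \in B); case jB: (j \in B); rewrite ?mulr0 ?oppr0 //.
rewrite ext_sign_setU1 ?jB // ext_sign_setD1 //.
have -> : j |: B :\ i = (j |: B) :\ i.
  apply/setP=> a; rewrite !inE; case: eqVneq => [->|_] /=; last by [].
  by rewrite eq_sym ij.
by rewrite (ext_sign_swap ij); ring.
Qed.

(** * Multiplication and contraction by arbitrary vectors *)

Definition wedge_sum v x : E := \sum_j v j *: wedge j x.
Definition contract_sum v x : E := \sum_j v j *: contract j x.

Fact wedge_sum_is_linear v : linear (wedge_sum v).
Proof.
move=> a x y; rewrite /wedge_sum scaler_sumr -big_split; apply: eq_bigr => j _.
by rewrite linearP scalerDr !scalerA mulrC.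
Qed.

HB.instance Definition _ v :=
  GRing.isLinear.Build Q E E *:%R (wedge_sum v) (wedge_sum_is_linear v).

Fact contract_sum_is_linear v : linear (contract_sum v).
Proof.
move=> a x y; rewrite /contract_sum scaler_sumr -big_split.
by apply: eq_bigr => j _; rewrite linearP scalerDr !scalerA mulrC.
Qed.

HB.instance Definition _ v :=
  GRing.isLinear.Build Q E E *:%R (contract_sum v) (contract_sum_is_linear v).

Lemma wedge_sumC v w x :
  wedge_sum v (wedge_sum w x) = - wedge_sum w (wedge_sum v x).
Proof.
rewrite /wedge_sum.
under eq_bigr do rewrite linear_sum scaler_sumr.
rewrite exchange_big /= -sumrN; apply: eq_bigr => j _.
rewrite linear_sum scaler_sumr -sumrN; apply: eq_bigr => i _.
by rewrite !linearZ /= wedgeC !scalerN !scalerA mulrC.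
Qed.

(** Equal vectors in [wedge_sumC] give only twice the claim, which says nothing in characteristic 2;
    instead the terms of the double sum cancel in pairs. *)
Lemma wedge_sum_sqr v x : wedge_sum v (wedge_sum v x) = 0.
Proof.
rewrite /wedge_sum.
under eq_bigr do rewrite linear_sum scaler_sumr.
apply: (sum_antisym (f := fun i j => v i *: wedge i (v j *: wedge j x)))
  => [i|i j].
  by rewrite linearZ /= wedge_wedge !scaler0.
by rewrite !linearZ /= wedgeC !scalerN !scalerA mulrC.
Qed.

Lemma contract_sumC v w x :
  contract_sum v (contract_sum w x) = - contract_sum w (contract_sum v x).
Proof.
rewrite /contract_sum.
under eq_bigr do rewrite linear_sum scaler_sumr.
rewrite exchange_big /= -sumrN; apply: eq_bigr => j _.
rewrite linear_sum scaler_sumr -sumrN; apply: eq_bigr => i _.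
by rewrite !linearZ /= contractC !scalerN !scalerA mulrC.
Qed.

Lemma contract_sum_sqr v x : contract_sum v (contract_sum v x) = 0.
Proof.
rewrite /contract_sum.
under eq_bigr do rewrite linear_sum scaler_sumr.
apply: (sum_antisym (f := fun i j => v i *: contract i (v j *: contract j x)))
  => [i|i j].
  by rewrite linearZ /= contract_contract !scaler0.
by rewrite !linearZ /= contractC !scalerN !scalerA mulrC.
Qed.

Lemma wedge_contract_sum j w x :
  wedge j (contract_sum w x) = w j *: x - contract_sum w (wedge j x).
Proof.
rewrite /contract_sum linear_sum /=.
under eq_bigr do rewrite linearZ /= wedge_contract scalerBr.
rewrite sumrB; congr (_ - _); rewrite (bigD1 j) //= big1 ?addr0 => [|i].
  by rewrite eqxx scale1r.
by rewrite eq_sym => /negbTE ->; rewrite scale0r scaler0.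
Qed.

(** Contraction by [w] is an antiderivation, so multiplication by [v] is a homotopy for the pairing
    of [v] and [w], as in a Koszul complex. *)
Lemma contract_wedge_sum v w x :
  contract_sum w (wedge_sum v x) + wedge_sum v (contract_sum w x)
  = (\sum_j v j * w j) *: x.
Proof.
rewrite {1}/wedge_sum linear_sum -big_split scaler_suml.
apply: eq_bigr => j _ /=.
by rewrite linearZ /= wedge_contract_sum scalerBr scalerA addrC subrK.
Qed.

(** * Restriction to the monomials that contain a fixed set *)

Definition restrict L x : E :=
  [ffun B : {set 'I_q} => if L \subset B then x B else 0].

Fact restrict_is_linear L : linear (restrict L).
Proof.
move=> a x y; apply/ffunP=> B; rewrite !ffunE.
by case: ifP; rewrite ?scaler0 ?addr0.
Qed.

HB.instance Definition _ L :=
  GRing.isLinear.Build Q E E *:%R (restrict L) (restrict_is_linear L).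

Lemma restrict_basis L A :
  restrict L (ext_basis A) = if L \subset A then ext_basis A else 0.
Proof.
apply/ffunP=> B; case LA: (L \subset A); rewrite !ffunE; case: ifP => // LB.
  by case: eqP => // BA; rewrite -BA LB in LA.
by case: eqP => // BA; rewrite BA LA in LB.
Qed.

Lemma restrict_idem L x : restrict L (restrict L x) = restrict L x.
Proof. by apply/ffunP=> B; rewrite !ffunE; case: ifP => // ->. Qed.

(** Inserting or deleting an index outside [L] does not affect whether a set contains [L]. *)
Lemma restrict_wedge L j x : j \notin L ->
  restrict L (wedge j x) = wedge j (restrict L x).
Proof.
move=> jL; apply/ffunP=> B; rewrite !ffunE subsetD1 jL andbT.
by case: ifP; case: ifP; rewrite ?mulr0.
Qed.

Lemma wedge_restrict0 L j x : j \in L -> wedge j (restrict L x) = 0.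
Proof.
move=> jL; apply/ffunP=> B; rewrite !ffunE subsetD1 jL andbF mulr0.
by case: ifP.
Qed.

Lemma restrict_contract0 L j x : j \in L -> restrict L (contract j x) = 0.
Proof.
move=> jL; apply/ffunP=> B; rewrite !ffunE; case: ifP => // LB.
by rewrite (subsetP LB).
Qed.

Lemma restrict_contract L j x : j \notin L ->
  restrict L (contract j x) = contract j (restrict L x).
Proof.
move=> jL; apply/ffunP=> B; rewrite !ffunE; case jB: (j \in B).
  by case: ifP.
have -> : (L \subset j |: B) = (L \subset B).
  by rewrite -[in RHS](setU1K (negbT jB)) subsetD1 jL andbT.
by case: ifP; rewrite ?mulr0.
Qed.

(** * The projection onto the span of the pivot faces *)

Section PivotProjection.
Variables (L : {set 'I_q}) (e : 'I_q).
Hypothesis eL : e \notin L.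

Definition contract_all : E -> E := contract_sum (fun=> 1).
Definition contract_in : E -> E := contract_sum (fun i => (i \in L)%:R).

HB.instance Definition _ := GRing.Linear.on contract_all.
HB.instance Definition _ := GRing.Linear.on contract_in.

(** The kernel is the ideal generated by the product of the e_i - e over [i] in [L], whose expansion
    is e_L - e d'(e_L) as e squares to 0. Since d kills each e_i - e, it preserves this kernel. *)
Definition pivot_proj x : E :=
  x - restrict L x + wedge e (contract_in (restrict L x)).

HB.instance Definition _ := GRing.Linear.copy pivot_proj
  ((idfun \- restrict L) \+ (wedge e \o (contract_in \o restrict L))).

Lemma pivot_proj_id x : restrict L x = 0 -> pivot_proj x = x.
Proof. by move=> Rx; rewrite /pivot_proj Rx subr0 2!linear0 addr0. Qed.

Lemma pivot_proj_wedge_basis j A : j \notin A ->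
  pivot_proj (wedge j (ext_basis A)) = ext_sign j A *:
  (if L \subset j |: A then wedge e (contract_in (ext_basis (j |: A)))
   else ext_basis (j |: A)).
Proof.
move=> jA; rewrite wedge_basis (negbTE jA) linearZ /=; congr (_ *: _).
rewrite /pivot_proj restrict_basis; case: ifP => _.
  by rewrite subrr add0r.
by rewrite subr0 2!linear0 addr0.
Qed.

(** For [L] equal to [[l]] and [e] the index l+1, this is the inner sum of case (iii), with its
    signs not yet evaluated. *)
Lemma wedge_contract_in_basis A : L \subset A -> e \notin A ->
  wedge e (contract_in (ext_basis A)) =
  \sum_(i in L) (ext_sign i (A :\ i) * ext_sign e (A :\ i))
    *: ext_basis (e |: A :\ i).
Proof.
move=> LA eA; rewrite /contract_in /contract_sum linear_sum [RHS]big_mkcond.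
apply: eq_bigr => i _ /=; case: ifP => iL; last by rewrite scale0r linear0.
have iA := subsetP LA _ iL.
rewrite scale1r contract_basis iA linearZ /=.
rewrite wedge_basis in_setD1 (negbTE eA) andbF.
by rewrite scalerA ext_sign_setD1id.
Qed.

(** As [e] lies outside [L], multiplication by e anticommutes with d', and e kills e_A. This is why
    case (ii) drops the term of [t]. *)
Lemma wedge_contract_in_basis0 A :
  e \in A -> wedge e (contract_in (ext_basis A)) = 0.
Proof.
move=> eA; rewrite /contract_in wedge_contract_sum (negbTE eL) scale0r.
by rewrite wedge_basis eA linear0 subr0.
Qed.

Lemma restrict_contract_in x : restrict L (contract_in x) = 0.
Proof.
rewrite /contract_in /contract_sum linear_sum big1 // => j _.
rewrite linearZ /=; case jL: (j \in L); last by rewrite scale0r.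
by rewrite restrict_contract0 ?scaler0.
Qed.

(** Contracting an index of [L] leaves no set containing [L], while the other contractions commute
    with [restrict]; so only the indices outside [L] survive. *)
Lemma restrict_contract_all x :
  restrict L (contract_all x)
  = contract_all (restrict L x) - contract_in (restrict L x).
Proof.
rewrite /contract_all /contract_in /contract_sum linear_sum -sumrB.
apply: eq_bigr => j _ /=; rewrite linearZ /= scale1r; case jL: (j \in L).
  by rewrite restrict_contract0 // scaler0 scale1r subrr.
by rewrite restrict_contract ?jL // scale0r scale1r subr0.
Qed.

Lemma contract_all_wedge j x :
  contract_all (wedge j x) = x - wedge j (contract_all x).
Proof. by rewrite /contract_all wedge_contract_sum scale1r subKr. Qed.

(** With r the restriction of [x], both sides equal dx - dr + d'r - e d d'r, because d'd' = 0 and d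
    d' = - d'd. *)
Lemma pivot_proj_contract x :
  pivot_proj (contract_all x) = contract_all (pivot_proj x).
Proof.
rewrite /pivot_proj restrict_contract_all; set r := restrict L x.
rewrite [contract_in (_ - _)]linearB [contract_all (_ + _)]linearD /=.
rewrite [contract_all (x - r)]linearB contract_all_wedge /=.
rewrite [contract_in (contract_in r)]contract_sum_sqr subr0.
rewrite [contract_all (contract_in r)]contract_sumC [wedge e (- _)]linearN /=.
by rewrite opprD !opprK !addrA.
Qed.

Lemma contract_in_wedge j x :
  contract_in (wedge j x) = (j \in L)%:R *: x - wedge j (contract_in x).
Proof. by rewrite /contract_in wedge_contract_sum subKr. Qed.

Lemma pivot_proj_wedge_restrict j x : j \notin L ->
  pivot_proj (wedge j (restrict L x))
  = wedge j (wedge e (contract_in (restrict L x))).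
Proof.
move=> jL; rewrite /pivot_proj restrict_wedge // restrict_idem subrr add0r.
rewrite contract_in_wedge (negbTE jL) scale0r add0r linearN /=.
by rewrite [in RHS]wedgeC.
Qed.

(** The kernel of pi is a left ideal: with r the restriction of [x], the claim reduces to pi(e_j e
    d'r) = pi(e_j r). *)
Lemma pivot_proj_wedge j x :
  pivot_proj (wedge j (pivot_proj x)) = pivot_proj (wedge j x).
Proof.
rewrite {2}/pivot_proj !linearD !linearN /= -addrA -[RHS]addr0; congr (_ + _).
apply/eqP; rewrite addrC subr_eq0; apply/eqP.
have [jL|jL] := boolP (j \in L).
  (* Here e_j r = 0, so the right side vanishes and the Clifford relation gives e_j d'r = r. The
     left side becomes - pi(e r) = - e e d'r = 0. *)
  rewrite [in RHS]wedge_restrict0 // linear0 wedgeC.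
  have -> : wedge j (contract_in (restrict L x)) = restrict L x.
    apply/esym/eqP; rewrite -subr_eq0 -[X in X - _]scale1r.
    have := contract_in_wedge j (restrict L x).
    by rewrite jL wedge_restrict0 // linear0 => <-.
  by rewrite linearN /= pivot_proj_wedge_restrict // wedge_wedge oppr0.
(* For [j] outside [L] both sides are e_j e d'r, which pi fixes since none of its monomials contains
   [L]. *)
rewrite pivot_proj_wedge_restrict // pivot_proj_id //.
by rewrite !restrict_wedge // restrict_contract_in !linear0.
Qed.

Lemma pivot_proj_wedge_sum v x :
  pivot_proj (wedge_sum v (pivot_proj x)) = pivot_proj (wedge_sum v x).
Proof.
rewrite /wedge_sum !linear_sum; apply: eq_bigr => j _.
by rewrite !linearZ /= pivot_proj_wedge.
Qed.

End PivotProjection.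

End ExteriorAlgebra.

Lemma ffun_delta_sum (R : comNzRingType) (B : finType) (x : {ffun B -> R^o}) :
  x = \sum_b (x b : R) *: [ffun b' => (b' == b)%:R].
Proof.
apply/ffunP=> b; rewrite sum_ffunE (bigD1 b) //= !ffunE eqxx big1.
  by rewrite addr0 /GRing.scale /= mulr1.
move=> b'; rewrite !ffunE eq_sym => /negbTE ->.
by rewrite /GRing.scale /= mulr0.
Qed.

(** * Divisibility of least common multiples *)

Section Monomials.
Variables (n q : nat) (m : 'I_q -> 'X_{1..n}).
Implicit Types (A B : {set 'I_q}) (b : 'X_{1..n}).

Lemma lem_lcm_set A b :
  (lcm_set m A <= b)%MM = [forall j in A, (m j <= b)%MM].
Proof.
rewrite -big_andE /lcm_set.
apply: (big_morph (fun x => (x <= b)%MM)) => [x y|]; first exact: lem_mlcm.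
by apply/mnm_lepP=> i; rewrite mnm0E.
Qed.

Lemma lem_lcm_mem A j : j \in A -> (m j <= lcm_set m A)%MM.
Proof.
by have := lepm_refl (lcm_set m A); rewrite lem_lcm_set => /forall_inP; apply.
Qed.

Lemma lcm_setS A B : A \subset B -> (lcm_set m A <= lcm_set m B)%MM.
Proof.
move=> AB; rewrite lem_lcm_set; apply/forall_inP=> j jA.
by rewrite lem_lcm_mem ?(subsetP AB).
Qed.

Lemma lem_addl b b' : (b <= b + b')%MM.
Proof. by apply/mnm_lepP=> i; rewrite mnmDE leq_addr. Qed.

(** This makes the truncated subtraction of exponents in the Taylor homotopy an exact division. *)
Lemma lcm_setU1_le j A : (lcm_set m (j |: A) <= m j + lcm_set m A)%MM.
Proof.
rewrite lem_lcm_set; apply/forall_inP=> i /setU1P [->|iA].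
  exact: lem_addl.
by rewrite addmC (lepm_trans (lem_lcm_mem iA)) // lem_addl.
Qed.

End Monomials.

(** * Embedding of the pivot complex into the exterior algebra *)

Section Embedding.
Variables (k : fieldType) (n q : nat) (m : 'I_q -> 'X_{1..n}) (l : nat).
Local Notation Q := {mpoly k[n]}.
Local Notation mA := (lcm_set m).
Local Notation L := (initial q l).
Local Notation M := (pivot_module k n q l).
Local Notation E := {ffun {set 'I_q} -> Q^o}.
Implicit Types (A B : {set 'I_q}) (x y : M).
Local Notation eps := (@eps k n q l).
Local Notation F := (@ext_basis Q q).

Definition embed x : E :=
  [ffun B : {set 'I_q} => 
    (if insub B is Some b then ('X_[mA B] : Q) * (x b : Q) else 0) : Q^o].

Fact embed_is_linear : linear embed.
Proof.
move=> a x y; apply/ffunP=> B; rewrite !ffunE; case: insubP => [b _ _|_].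
  by rewrite !ffunE mulrDr /GRing.scale /= mulrCA.
by rewrite scaler0 addr0.
Qed.

HB.instance Definition _ :=
  GRing.isLinear.Build Q M E *:%R embed embed_is_linear.

(** Multiplication by a monomial only shifts exponents, so it loses no coefficient. Identities on
    the pivot complex can thus be tested in the exterior algebra. *)
Lemma embed_inj : injective embed.
Proof.
apply: raddf_inj => x /ffunP x0; apply/ffunP=> b.
have := x0 (val b); rewrite !ffunE valK => /mpolyP b0.
apply/mpolyP=> u.
by rewrite -(mcoeffMX (x b : Q) (mA (val b))) mulrC b0 !mcoeff0.
Qed.

Lemma embed_eps A :
  embed (eps A) = if L \subset A then 0 else 'X_[mA A] *: F A.
Proof.
apply/ffunP=> B; rewrite !ffunE; case: insubP => [b nB <-|/negPn LB].
  rewrite ffunE; case: eqP => [<-|bA].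
    by rewrite (negbTE (valP b)) !ffunE eqxx.
  case: ifP => _; rewrite !ffunE ?mulr0 //.
  by move/eqP/negbTE: bA => ->; rewrite /GRing.scale /= mulr0.
case: ifP => LA; rewrite !ffunE //; case: eqP => [BA|_].
  by rewrite -BA LB in LA.
by rewrite /GRing.scale /= mulr0.
Qed.

Lemma pivot_module_sum x : x = \sum_b (x b : Q) *: eps (val b).
Proof.
by rewrite [LHS]ffun_delta_sum; apply: eq_bigr => b _; congr (_ *: _).
Qed.

Lemma linear_eps_eq (V : lmodType Q) (f g : {linear M -> V}) :
  (forall A : face q l, f (eps (val A)) = g (eps (val A))) -> f =1 g.
Proof.
move=> fg x; rewrite [x]pivot_module_sum !linear_sum; apply: eq_bigr => A _.
by rewrite !linearZ /= fg.
Qed.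

Lemma restrict_embed x : restrict L (embed x) = 0.
Proof.
apply/ffunP=> B; rewrite !ffunE; case: ifP => // LB.
by rewrite insubF ?LB.
Qed.

Lemma mpolyX_divK (b b' : 'X_{1..n}) :
  (b <= b')%MM -> 'X_[b' - b] * 'X_[b] = 'X_[b'] :> Q.
Proof. by move=> bb'; rewrite -mpolyXD submK. Qed.

Lemma embed_diff x : embed (pivot_diff k m l x) = contract_all (embed x).
Proof.
apply: (linear_eps_eq (f := embed \o pivot_diff k m l)
                      (g := @contract_all _ _ \o embed)) => A /=.
rewrite lin_ext_eps linear_sum embed_eps (negbTE (valP A)) linearZ /=.
rewrite /contract_all /contract_sum big_mkcond scaler_sumr.
apply: eq_bigr => j _ /=; rewrite scale1r contract_basis.
case: ifP => jA; last by rewrite scaler0.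
(* A subset of a face is a face, so no term is lost. *)
rewrite linearZ /= embed_eps ifN; last first.
  by apply: contra (valP A) => /subset_trans; apply; apply: subD1set.
rewrite sgn_ext_sign ?setD11; last by [].
rewrite (ext_sign_setD1id _ jA).
rewrite !scalerA -mulrA.
rewrite (mpolyX_divK (lcm_setS _ (subD1set _ _))).
by rewrite mulrC.
Qed.

(** * The homotopy as a projected multiplication *)

Section Homotopy.
Variables (l1 : 'I_q) (c : 'I_q -> Q).
Hypotheses (l1E : l1 = l :> nat) (l_gt0 : (0 < l)%N).
Hypothesis gap : (m l1 <= mA L)%MM.

Let l1L : l1 \notin L.
Proof. by rewrite inE l1E ltnn. Qed.

(** The elements of [A :\ i] below l+1 are the l-1 elements of [L :\ i], and l-1 has the parity of
    l+1. This is the constant sign in case (iii). *)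
Lemma ext_sign_l1 A i : i \in L -> L \subset A ->
  ext_sign Q l1 (A :\ i) = (-1) ^+ l.+1.
Proof.
move=> iL LA; rewrite /ext_sign.
have -> : [set j in A :\ i | (j < l1)%N] = L :\ i.
  apply/setP=> j; rewrite !inE l1E -andbA; congr (_ && _).
  by case: ltnP => jl; rewrite ?andbF // andbT (subsetP LA) ?inE.
have := cardsD1 i L; rewrite iL (card_initial l1E) /= => {2}->.
by rewrite add1n !exprS mulrA mulrNN !mul1r.
Qed.

Lemma missing_one A :
  #|A :&: L| = l.-1 -> exists t, L :\: A = [set t].
Proof.
move=> cardA; apply/cards1P.
rewrite -(eqn_add2l #|L :&: A|) cardsID (card_initial l1E).
(* Here [0 < l] matters: for [l = 0] the truncated [l.-1] is 0 and no element would be missing. *)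
by rewrite setIC cardA addn1 prednK.
Qed.

Lemma embed_taylor_term j A : j \notin A -> ~~ (L \subset j |: A) ->
  embed ((sgn Q [set j] A * c j * 'X_[m j + mA A - mA (j |: A)])
           *: eps (j |: A))
  = (c j * 'X_[m j]) *: pivot_proj L l1 (wedge j ('X_[mA A] *: F A)).
Proof.
move=> jA nL; rewrite linearZ /= embed_eps (negbTE nL).
rewrite [wedge j _]linearZ [pivot_proj _ _ _]linearZ /=.
rewrite (pivot_proj_wedge_basis _ L l1 jA) (negbTE nL).
rewrite (sgn_ext_sign _ jA) !scalerA -!mulrA.
rewrite mpolyX_divK; last exact: lcm_setU1_le.
rewrite mpolyXD. by congr (_ *: _); ring.
Qed.

Lemma embed_pivot_sum t A : t \notin A -> l1 \notin A -> t \in L ->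
  L \subset t |: A ->
  embed (((-1) ^+ l.+1 * sgn Q [set t] A * c t) *: pivot_sum k m l l1 t A)
  = (c t * 'X_[m t]) *: pivot_proj L l1 (wedge t ('X_[mA A] *: F A)).
Proof.
move=> tA l1A tL LC; rewrite linearZ /=.
rewrite [wedge t _]linearZ [pivot_proj _ _ _]linearZ /=.
rewrite (pivot_proj_wedge_basis _ L l1 tA) LC.
have nl1C : l1 \notin t |: A.
  by rewrite in_setU1 negb_or l1A andbT; apply: contraNneq l1L => ->.
rewrite wedge_contract_in_basis; [|exact: LC|exact: nl1C].
rewrite /pivot_sum linear_sum !scaler_sumr; apply: eq_bigr => i iL.
have nil1 : i != l1 by apply: contraNneq l1L => <-.
have -> : (t |: (l1 |: A)) :\ i = l1 |: ((t |: A) :\ i).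
  apply/setP=> j; rewrite !inE; case: (eqVneq j l1) => [->|_]; last by [].
  by rewrite eq_sym nil1 orbT.
(* As l+1 is a gap, m_{l+1} divides m_[l] and hence the lcm of [t |: A]; so the quotient in (iii) is
   exact. *)
have le_lcm : (mA (l1 |: (t |: A) :\ i) <= m t + mA A)%MM.
  apply: lepm_trans (lcm_setU1_le m t A); rewrite lem_lcm_set.
  apply/forall_inP => j /setU1P [->|].
    exact: lepm_trans gap (lcm_setS _ LC).
  by move=> /setD1P [_ jC]; apply: lem_lcm_mem.
rewrite linearZ /= embed_eps ifN; last first.
  by apply/subsetPn; exists i; rewrite // !inE (negbTE nil1) eqxx.
rewrite (sgn_ext_sign _ tA) (sgn_ext_sign _ (negbT (setD11 i _))).
rewrite (ext_sign_l1 iL LC) !scalerA -!mulrA (mpolyX_divK le_lcm) mpolyXD.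
by congr (_ *: _); ring.
Qed.

(** Both sides are compared term by term over [j] outside [A]; pi alters a term only if [j |: A]
    contains [[l]]. *)
Lemma embed_homotopy_basis A : ~~ (L \subset A) ->
  embed (homotopy_basis m l l1 c A) = pivot_proj L l1
    (wedge_sum (fun j => c j * 'X_[m j]) ('X_[mA A] *: F A)).
Proof.
move=> nLA; rewrite [in RHS]/wedge_sum linear_sum.
pose T j := (c j * 'X_[m j]) *: pivot_proj L l1 (wedge j ('X_[mA A] *: F A)).
transitivity (\sum_(j | j \notin A) T j); last first.
  rewrite big_mkcond; apply: eq_bigr => j _ /=; rewrite linearZ /=.
  case: ifPn => // /negPn jA.
  by rewrite [wedge j _]linearZ /= wedge_basis jA scaler0 linear0 scaler0.
have embed_taylor (D : {set 'I_q}) : A \subset D ->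
    (forall j, j \notin D -> ~~ (L \subset j |: A)) ->
    embed (taylor_sum m l c A D) = \sum_(j | j \notin D) T j.
  move=> AD nLD; rewrite linear_sum; apply: eq_bigr => j jD.
  by apply: embed_taylor_term; [apply: contra jD; apply: subsetP|apply: nLD].
rewrite /homotopy_basis; case: ifPn => [cardA|/negPn/eqP cardA].
  (* If [j |: A] contained [[l]], then [A] would meet [[l]] in [[l]] without [j], which has l-1
     elements. *)
  apply: embed_taylor => // j jA; apply: contra cardA => LjA.
  have jL : j \in L.
    apply: contraR nLA => jL; rewrite -(setU1K jA).
    by rewrite subsetD1 LjA.
  have <- : L :\ j = A :&: L.
    apply/setP=> i; rewrite in_setD1 in_setI; case: eqP => [->|/eqP ij].
      by rewrite (negbTE jA).
    case iL: (i \in L); rewrite ?andbF //= andbT; apply/esym.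
    by have := subsetP LjA _ iL; rewrite in_setU1 (negbTE ij).
  by rewrite -[l in l.-1](card_initial l1E) (cardsD1 j L) jL.
have [t LAt] := missing_one cardA.
have /setDP [tL tA] : t \in L :\: A by rewrite LAt set11.
have LC : L \subset t |: A by rewrite setUC -subDset LAt.
have notinU j : (j \notin t |: A) = (j \notin A) && (j != t).
  by rewrite in_setU1 negb_or andbC.
have embed_t : embed (taylor_sum m l c A (t |: A))
    = \sum_(j | (j \notin A) && (j != t)) T j.
  rewrite embed_taylor ?subsetUr // => [|j]; first exact: eq_bigl.
  rewrite notinU => /andP [_ jt]; apply/subsetPn; exists t => //.
  by rewrite in_setU1 negb_or eq_sym jt.
case: pickP => [t'|/(_ t)]; last by rewrite LAt set11.
rewrite LAt inE => /eqP -> {t'}.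
(* The term of [t] is the only one that pi alters: it vanishes if l+1 lies in [A], and otherwise
   becomes the correction in (iii). *)
rewrite (bigD1 t tA) /= -embed_t; case: ifPn => l1A.
  suff -> : T t = 0 by rewrite add0r.
  rewrite /T [wedge t _]linearZ [pivot_proj _ _ _]linearZ /=.
  rewrite (pivot_proj_wedge_basis _ L l1 tA) LC.
  rewrite wedge_contract_in_basis0; [|exact: l1L|exact: (setU1r _ l1A)].
  by rewrite !scaler0.
rewrite linearD addrC /=; congr (_ + _); exact: embed_pivot_sum.
Qed.

Lemma embed_homotopy x :
  embed (homotopy m l l1 c x)
  = pivot_proj L l1 (wedge_sum (fun j => c j * 'X_[m j]) (embed x)).
Proof.
apply: (linear_eps_eq (f := embed \o homotopy m l l1 c)
  (g := @pivot_proj _ _ L l1 \o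
        (wedge_sum (fun j => c j * 'X_[m j]) \o embed))) => A /=.
rewrite homotopyE embed_eps (negbTE (valP A)).
by rewrite (embed_homotopy_basis (valP A)).
Qed.

End Homotopy.
End Embedding.

(** * Homological degrees of linear extensions *)

Section Degrees.
Variables (R : comNzRingType) (B : finType) (deg : B -> nat).
Local Notation M := {ffun B -> R^o}.
Implicit Types (i d : int) (x y : M).

Lemma in_degree0 i : in_degree deg i (0 : M).
Proof. by move=> b; rewrite ffunE eqxx. Qed.

Lemma in_degreeD i x y :
  in_degree deg i x -> in_degree deg i y -> in_degree deg i (x + y).
Proof.
move=> xi yi b; rewrite ffunE; have [x0|/xi //] := eqVneq (x b) 0.
by rewrite x0 add0r => /yi.
Qed.

Lemma in_degreeZ i (a : R) x : in_degree deg i x -> in_degree deg i (a *: x).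
Proof.
move=> xi b axb; apply: xi; apply: contraNneq axb => xb.
by rewrite ffunE xb scaler0.
Qed.

Lemma in_degree_sum i (I : finType) (P : pred I) (f : I -> M) :
  (forall j, P j -> in_degree deg i (f j)) ->
  in_degree deg i (\sum_(j | P j) f j).
Proof.
by move=> fi; elim/big_ind: _ => //; [exact: in_degree0|exact: in_degreeD].
Qed.

Lemma in_degree_lin_ext i d (f : B -> M) x :
  (forall b, in_degree deg ((deg b)%:Z + d) (f b)) ->
  in_degree deg i x -> in_degree deg (i + d) (lin_ext f x).
Proof.
move=> fd xi; apply: in_degree_sum => b _.
have [->|xb] := eqVneq (x b) 0; first by rewrite scale0r; exact: in_degree0.
by rewrite -(xi b xb); apply/in_degreeZ/fd.
Qed.

End Degrees.

(** * Degrees and quadratic relations of the pivot homotopies *)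

Section Homotopies.
Variables (k : fieldType) (n q : nat) (m : 'I_q -> 'X_{1..n}) (l : nat).
Variable l1 : 'I_q.
Local Notation Q := {mpoly k[n]}.
Local Notation mA := (lcm_set m).
Local Notation L := (initial q l).
Local Notation M := (pivot_module k n q l).
Hypotheses (l1E : l1 = l :> nat) (l_gt0 : (0 < l)%N).
Implicit Types (A : {set 'I_q}) (c : 'I_q -> Q) (x : M).

(** When [A] contains [[l]], the element is zero, and zero lies in every degree. *)
Lemma in_degree_eps A (d : int) :
  #|A|%:Z = d -> in_degree (@face_deg q l) d (eps k n l A).
Proof.
move=> Ad b; rewrite ffunE; have [bA _|_] := eqVneq (val b) A.
  by rewrite /face_deg bA.
by rewrite eqxx.
Qed.

Lemma in_degree_taylor_sum c A (D : {set 'I_q}) : A \subset D ->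
  in_degree (@face_deg q l) (#|A|%:Z + 1) (taylor_sum m l c A D).
Proof.
move=> AD; apply: in_degree_sum => j jD; apply/in_degreeZ/in_degree_eps.
by rewrite cardsU1 (contra (subsetP AD j) jD) addrC.
Qed.

Lemma in_degree_pivot_sum t A :
  t \in L -> t \notin A -> l1 \notin A -> L \subset t |: A ->
  in_degree (@face_deg q l) (#|A|%:Z + 1) (pivot_sum k m l l1 t A).
Proof.
move=> tL tA l1A LC; apply: in_degree_sum => i iL.
apply/in_degreeZ/in_degree_eps.
have l1L : l1 \notin L by rewrite inE l1E ltnn.
have iC : i \in t |: (l1 |: A).
  by have := subsetP LC _ iL; rewrite !inE => /orP[]->; rewrite ?orbT.
have nl1C : l1 \notin t |: A.
  by rewrite in_setU1 negb_or l1A andbT; apply: contraNneq l1L => ->.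
(* Two elements are added and one is removed, so the cardinality grows by one. *)
have := cardsD1 i (t |: (l1 |: A)).
rewrite iC setUCA cardsU1 nl1C cardsU1 tA !add1n => -[<-].
by rewrite -addn1 PoszD.
Qed.

Lemma in_degree_homotopy c (i : int) x :
  in_degree (@face_deg q l) i x ->
  in_degree (@face_deg q l) (i + 1) (homotopy m l l1 c x).
Proof.
apply: in_degree_lin_ext => A; rewrite /face_deg /homotopy_basis.
case: ifP => [_|/negbFE/eqP cardA]; first exact: in_degree_taylor_sum.
case: pickP => [t|_]; last exact: in_degree0.
move=> tLA; have /setDP [tL tA] := tLA.
have tsum : in_degree (@face_deg q l) (#|val A|%:Z + 1)
  (taylor_sum m l c (val A) (t |: val A)).
  by apply: in_degree_taylor_sum; apply: subsetUr.
case: ifPn => // l1A; apply: in_degreeD => //; apply: in_degreeZ.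
apply: in_degree_pivot_sum => //.
have [t' Lt'] := missing_one l1E l_gt0 cardA.
by move: tLA; rewrite setUC -subDset Lt' inE => /eqP ->.
Qed.

Hypothesis gap : (m l1 <= mA L)%MM.

Let l1L : l1 \notin L.
Proof. by rewrite inE l1E ltnn. Qed.

(** The inner projection is absorbed by the outer one, since the kernel of pi is a left ideal. *)
Lemma embed_homotopy2 c c' x :
  embed m (homotopy m l l1 c (homotopy m l l1 c' x))
  = pivot_proj L l1 (wedge_sum (fun j => c j * 'X_[m j])
      (wedge_sum (fun j => c' j * 'X_[m j]) (embed m x))).
Proof.
rewrite (embed_homotopy _ l1E l_gt0 gap) (embed_homotopy _ l1E l_gt0 gap).
exact: pivot_proj_wedge_sum.
Qed.

Lemma homotopyC c c' x :
  homotopy m l l1 c (homotopy m l l1 c' x)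
  = - homotopy m l l1 c' (homotopy m l l1 c x).
Proof.
apply: (@embed_inj _ _ _ m).
have -> y : embed m (- y) = - embed m y by exact: linearN.
rewrite [in LHS]embed_homotopy2 embed_homotopy2 wedge_sumC.
by rewrite [pivot_proj _ _ (- _)]linearN.
Qed.

Lemma homotopy_sqr c x : homotopy m l l1 c (homotopy m l l1 c x) = 0.
Proof.
apply: (@embed_inj _ _ _ m).
have -> : embed m (0 : M) = 0 by exact: linear0.
by rewrite embed_homotopy2 wedge_sum_sqr [pivot_proj _ _ 0]linear0.
Qed.

(** Since pi commutes with d, the left side becomes pi(dW + Wd), where dW + Wd is a scalar; and pi
    fixes the image of [embed]. *)
Lemma homotopy_diff c x :
  pivot_diff k m l (homotopy m l l1 c x)
  + homotopy m l l1 c (pivot_diff k m l x)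
  = (\sum_j c j * 'X_[m j]) *: x.
Proof.
apply: (@embed_inj _ _ _ m).
pose W := wedge_sum (fun j => c j * 'X_[m j]).
have embed_dh : embed m (pivot_diff k m l (homotopy m l l1 c x))
    = contract_all (pivot_proj L l1 (W (embed m x))).
  apply: (etrans (embed_diff m _)).
  exact: (congr1 _ (embed_homotopy c l1E l_gt0 gap x)).
have embed_hd : embed m (homotopy m l l1 c (pivot_diff k m l x))
    = pivot_proj L l1 (W (contract_all (embed m x))).
  apply: (etrans (embed_homotopy c l1E l_gt0 gap _)).
  exact: (congr1 (fun y => pivot_proj L l1 (W y)) (embed_diff m x)).
have embedD y z : embed m (y + z) = embed m y + embed m z by exact: linearD.
have embedZ b y : embed m (b *: y) = b *: embed m y by exact: linearZ.
rewrite embedD embedZ.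
apply: (etrans (congr2 _ embed_dh embed_hd)).
rewrite -(pivot_proj_contract _ l1).
have <- : forall y z,
    pivot_proj L l1 (y + z) = pivot_proj L l1 y + pivot_proj L l1 z.
  by move=> ? y z; exact: linearD.
rewrite /contract_all /W contract_wedge_sum [pivot_proj _ _ _]linearZ /=.
rewrite (pivot_proj_id l1 (restrict_embed _ _)); congr (_ *: _).
by apply: eq_bigr => j _; rewrite mulr1.
Qed.

Lemma pivot_homotopies0 r (c : 'I_r -> 'I_q -> Q) :
  pivot_homotopies m l l1 c 0%MM = pivot_diff k m l.
Proof. by rewrite /pivot_homotopies eqxx. Qed.

Lemma pivot_homotopies1 r (c : 'I_r -> 'I_q -> Q) s :
  pivot_homotopies m l l1 c U_(s)%MM = homotopy m l l1 (c s).
Proof.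
rewrite /pivot_homotopies mnm1_eq0; case: pickP => [s' /eqP ss'|/(_ s)].
  suff -> : s' = s by [].
  by move/mnmP/(_ s'): ss'; rewrite !mnm1E eqxx; case: eqP.
by rewrite eqxx.
Qed.

Lemma pivot_homotopies_ge2 r (c : 'I_r -> 'I_q -> Q) u x :
  (2 <= mdeg u)%N -> pivot_homotopies m l l1 c u x = 0.
Proof.
move=> u2; rewrite /pivot_homotopies -mdeg_eq0; case: eqP u2 => [->//|_ u2].
case: pickP => [s /eqP us|_]; first by move: u2; rewrite us mdeg1.
by rewrite /= /lin_ext big1 // => b _; rewrite scaler0.
Qed.

Lemma mdeg_cases r (u : 'X_{1..r}) :
  [\/ u = 0%MM, exists s, u = U_(s)%MM | (2 <= mdeg u)%N].
Proof.
case Eu: (mdeg u) => [|[|d]]; last by constructor 3.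
  by constructor 1; apply/eqP; rewrite -mdeg_eq0 Eu.
by constructor 2; have /eqP/mdeg1P [s /eqP us] := Eu; exists s.
Qed.

(** The bound excludes 0 paired with a unit vector, where the anticommutator is a_s. What is left is
    two unit vectors, or an index of weight at least 2, for which both composites vanish. *)
Lemma pivot_homotopiesC r (c : 'I_r -> 'I_q -> Q) u v x :
  (2 <= mdeg (u + v))%N ->
  pivot_homotopies m l l1 c u (pivot_homotopies m l l1 c v x)
  = - pivot_homotopies m l l1 c v (pivot_homotopies m l l1 c u x).
Proof.
have zeroC w : (2 <= mdeg w)%N -> forall f : {linear M -> M},
    pivot_homotopies m l l1 c w (f x) = - f (pivot_homotopies m l l1 c w x)
    /\ f (pivot_homotopies m l l1 c w x) = - pivot_homotopies m l l1 c w (f x).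
  move=> w2 f.
  move: (pivot_homotopies_ge2 c (f x) w2) (pivot_homotopies_ge2 c x w2).
  by move: (pivot_homotopies m l l1 c w) => g -> ->; rewrite linear0 oppr0.
have [->|[s ->]|u2 _] := mdeg_cases u; last exact: (zeroC u u2 _).1.
- by rewrite add0m => v2; exact: (zeroC v v2 _).2.
have [->|[t ->] _|v2 _] := mdeg_cases v; last exact: (zeroC v v2 _).2.
  by rewrite addm0 mdeg1.
move: (pivot_homotopies1 c s) (pivot_homotopies1 c t).
move: (pivot_homotopies m l l1 c U_(s)%MM) (pivot_homotopies m l l1 c U_(t)%MM).
by move=> f g -> ->; exact: homotopyC.
Qed.

Lemma pivot_homotopies_sqr r (c : 'I_r -> 'I_q -> Q) u x :
  (2 <= mdeg (u + u))%N ->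
  pivot_homotopies m l l1 c u (pivot_homotopies m l l1 c u x) = 0.
Proof.
have [->|[s ->] _|u2 _] := mdeg_cases u; first by rewrite addm0 mdeg0.
  move: (pivot_homotopies1 c s).
  by move: (pivot_homotopies m l l1 c U_(s)%MM) => f ->; exact: homotopy_sqr.
exact: pivot_homotopies_ge2.
Qed.

End Homotopies.

(** * The axioms of a system of higher homotopies *)

Theorem theorem5p1 (k : fieldType) (n q : nat) (m : 'I_q -> 'X_{1..n})
  (l : nat) (l1 : 'I_q) (r : nat) (a : 'I_r -> {mpoly k[n]})
  (c : 'I_r -> 'I_q -> {mpoly k[n]}) :
  minimal_generators (fun j => 'X_[m j] : {mpoly k[n]}) ->
  scarf_number m = Some l ->
  (* l1 is the index l + 1, as indices are 0-based *)
  l1 = l :> nat ->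
  is_gap m l1 (initial q l) ->
  is_pivot_resolution k m l ->
  regular_sequence a ->
  (forall x, in_ideal predT a x -> monomial_ideal m x) ->
  (forall s, a s = \sum_j c s j * 'X_[m j]) ->
  higher_homotopies (@face_deg q l) (pivot_diff k m l) a
    (pivot_homotopies m l l1 c).
Proof.
move=> _ _ l1E /andP [_ gap] [l2 [[degd _] _ _]] _ _ aE.
have l_gt0 : (0 < l)%N by apply: leq_trans l2.
split=> [u i x xi|x|s x|u u2 x].
- have [->|[s ->]|u2] := mdeg_cases u.
  + rewrite mdeg0 muln0 addr0; move: (pivot_homotopies0 m l l1 c).
    by move: (pivot_homotopies m l l1 c 0%MM) => f ->; exact: degd.
  + rewrite mdeg1 muln1 -addrA; move: (pivot_homotopies1 m l l1 c s).
    move: (pivot_homotopies m l l1 c U_(s)%MM) => f ->.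
    exact: in_degree_homotopy.
  + move: (pivot_homotopies_ge2 m l1 c x u2).
    move: (pivot_homotopies m l l1 c u x) => y ->; exact: in_degree0.
- move: (pivot_homotopies0 m l l1 c).
  by move: (pivot_homotopies m l l1 c 0%MM) => f ->.
- move: (pivot_homotopies0 m l l1 c) (pivot_homotopies1 m l l1 c s).
  move: (pivot_homotopies m l l1 c 0%MM) (pivot_homotopies m l l1 c U_(s)%MM).
  by move=> f g -> ->; rewrite aE; exact: homotopy_diff.
(* Extended by zero to all pairs, the sum of axiom (3) has antisymmetric terms. A diagonal term,
   present when [u] is twice an index, vanishes by itself as a square. *)
pose f (b b' : 'X_{1..r < (mdeg u).+1}) :=
  if (b + b')%MM == u
  then pivot_homotopies m l l1 c b (pivot_homotopies m l l1 c b' x)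
  else 0.
rewrite big_mkcond -(pair_bigA _ f); apply: sum_antisym => [b|b b']; rewrite /f.
  by case: eqP => // bu; apply: pivot_homotopies_sqr; rewrite // bu.
rewrite [(b' + b)%MM]addmC; case: eqP => [bu|_]; last by rewrite oppr0.
by apply: pivot_homotopiesC; rewrite // bu.
Qed.
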